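(* Let $n\geq 2$, let $K\subsetneq 2^{[n]}$ be a simplicial complex, let $H_0=\{x\in\mathbb{R}^n\mid\sum x_i=0\}$ and $\delta_i=e_i-\frac1n(e_1+\dots+e_n)$. Assign to the vertices of $Bier(K)$ the rays $\rho_i=\delta_i$ and $\rho_{\bar j}=-\delta_j$ ($i,j\in[n]$), and let $\mathcal{F}$ be the complete simplicial fan in $H_0$ consisting of the cones $\mathrm{cone}(\{\delta_i\}_{i\in S}\cup\{-\delta_j\}_{j\in T})$, $(S,T)\in Bier(K)$ (the radial fan of the starshaped realization $\bigcup_{(S,T)\in Bier(K)}\mathrm{Conv}(\{\delta_i\}_{i\in S}\cup\{-\delta_j\}_{j\in T})$ of $Bier(K)$). Then $\mathcal{F}$ is the normal fan of a convex polytope if and only if $K$ admits a $K$-submodular function. More precisely, for a function $f:\{1,\dots,n,\bar1,\dots,\bar n\}\to\mathbb{R}$, the fan $\mathcal{F}$ is the normal fan of the polytope $P_f=\{x\in H_0\mid \langle\rho_v,x\rangle\leq f(v)\ \text{for all vertices } v\}$ if and only if $f$ is $K$-submodular; thus $f\mapsto P_f$ is a bijection between $K$-submodular functions and convex polytopes in $H_0$ with normal fan $\mathcal{F}$.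
   Context: A simplicial complex $K\subseteq 2^{[n]}$ is a family closed under subsets; $K^\circ=\{T\subseteq[n]\mid[n]\setminus T\notin K\}$ is its Alexander dual, and $Bier(K)=\{(S,T)\mid S\in K,T\in K^\circ,S\cap T=\emptyset\}$ is the Bier sphere, with vertex set $\{1,\dots,n,\bar1,\dots,\bar n\}$. Ridges of $Bier(K)$ (pairs $(S,T)$ with $|S|+|T|=n-2$) are written as $(X,Y)$ with $X=S\in K$, $Y=[n]\setminus T\notin K$, $Y=X\cup\{c_1,c_2\}$, $c_1\neq c_2$. Such a ridge is a $\Lambda$-configuration if $X\cup\{c_1\},X\cup\{c_2\}\in K$, a $V$-configuration if $X\cup\{c_1\},X\cup\{c_2\}\notin K$, and an $X$-configuration if exactly one of them is in $K$. A function $f:\{1,\dots,n,\bar1,\dots,\bar n\}\to\mathbb{R}$ is $K$-submodular if: (i) for every $\Lambda$-configuration, $f(c_1)+f(c_2)+\sum_{i\in X}f(i)>\sum_{j\notin Y}f(\bar j)$; (ii) for every $V$-configuration, $f(\bar c_1)+f(\bar c_2)+\sum_{j\notin Y}f(\bar j)>\sum_{i\in X}f(i)$; (iii) for every $X$-configuration, $f(c)+f(\bar c)>0$, where $c\in\{c_1,c_2\}$ is the element with $X\cup\{c\}\in K$. A fan is the normal fan of a polytope $P$ if its maximal cones are exactly the outer normal cones at the vertices of $P$.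
   Formalization: K is assumed to contain the empty face; P_f uses only inequalities at labels that are actual vertices of Bier(K), and in the bijection f is required to vanish at labels that are not vertices (otherwise, e.g. for K={∅}, the values of f there are unconstrained and the claim fails). *)

(* Defs.v *)
From HB Require Import structures.
From mathcomp Require Import all_boot all_order all_algebra.
From mathcomp Require Import boolp classical_sets functions reals.
Set Implicit Arguments.
Unset Strict Implicit.
Unset Printing Implicit Defensive.
Import Order.TTheory GRing.Theory Num.Theory.
Local Open Scope ring_scope.

(* The empty face is required: for the void family the Bier sphere would have
   no simplices at all. Not every i need be a vertex of K. *)
Definition simplicial_complex n (K : {set {set 'I_n}}) : Prop :=
  finset.set0 \in K /\
  (forall S T : {set 'I_n}, T \subset S -> S \in K -> T \in K).

Definition alexander_dual n (K : {set {set 'I_n}}) : {set {set 'I_n}} :=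
  [set T : {set 'I_n} | ~: T \notin K]%SET.

Definition bier n (K : {set {set 'I_n}}) : {set {set 'I_n} * {set 'I_n}} :=
  [set p : {set 'I_n} * {set 'I_n} |
    [&& p.1 \in K, p.2 \in alexander_dual K & p.1 :&: p.2 == finset.set0]]%SET.

(* [inl i] is the label i, [inr j] is the label \bar j. *)
Definition label n : Type := ('I_n + 'I_n)%type.

(* The labels that really are vertices of Bier(K). This can fail for some of the
   2n labels: i is a vertex iff {i} is in K, and \bar j iff [n] \ {j} is not. *)
Definition bier_vertex n (K : {set {set 'I_n}}) (v : label n) : bool :=
  match v with
  | inl i => ([set i]%SET, finset.set0) \in bier K
  | inr j => (finset.set0, [set j]%SET) \in bier K
  end.

Definition ridge n (K : {set {set 'I_n}}) (p : {set 'I_n} * {set 'I_n}) : Prop :=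
  p \in bier K /\ (#|p.1| + #|p.2| = n - 2)%N.

(* The ridge (S, T) written as (X, Y) with X = S, Y = [n] \ T and
   Y = X u {c1, c2}; since #|Y| = #|X| + 2, c1 and c2 are not in X. *)
Definition ridge_XY n (K : {set {set 'I_n}}) (X Y : {set 'I_n}) (c1 c2 : 'I_n) :
    Prop :=
  [/\ ridge K (X, (~: Y)%SET), Y = (X :|: [set c1; c2])%SET & c1 != c2].

Definition Lambda_configuration n (K : {set {set 'I_n}}) (X Y : {set 'I_n})
    (c1 c2 : 'I_n) : Prop :=
  [/\ ridge_XY K X Y c1 c2, (c1 |: X)%SET \in K & (c2 |: X)%SET \in K].

Definition V_configuration n (K : {set {set 'I_n}}) (X Y : {set 'I_n})
    (c1 c2 : 'I_n) : Prop :=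
  [/\ ridge_XY K X Y c1 c2, (c1 |: X)%SET \notin K & (c2 |: X)%SET \notin K].

(* [ridge_XY] is symmetric in its last two arguments, so the first of them, [c],
   may be taken to be the one with X u {c} in K. *)
Definition X_configuration n (K : {set {set 'I_n}}) (X Y : {set 'I_n})
    (c c' : 'I_n) : Prop :=
  [/\ ridge_XY K X Y c c', (c |: X)%SET \in K & (c' |: X)%SET \notin K].

Definition submodular (R : realType) n (K : {set {set 'I_n}})
    (f : label n -> R) : Prop :=
  [/\ forall X Y c1 c2, Lambda_configuration K X Y c1 c2 ->
        f (inl c1) + f (inl c2) + \sum_(i in X) f (inl i)
          > \sum_(j | j \notin Y) f (inr j),
      forall X Y c1 c2, V_configuration K X Y c1 c2 ->
        f (inr c1) + f (inr c2) + \sum_(j | j \notin Y) f (inr j)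
          > \sum_(i in X) f (inl i)
    & forall X Y c c', X_configuration K X Y c c' ->
        f (inl c) + f (inr c) > 0].

Definition dot (R : realType) n (u x : 'rV[R]_n) : R :=
  \sum_(i < n) u 0 i * x 0 i.

Definition H0 (R : realType) n : set 'rV[R]_n :=
  [set x : 'rV[R]_n | \sum_(i < n) x 0 i = 0]%classic.
Arguments H0 {R n}.

Definition delta (R : realType) n (i : 'I_n) : 'rV[R]_n :=
  delta_mx 0 i - n%:R^-1 *: \sum_(j < n) delta_mx 0 j.

Definition rho (R : realType) n (v : label n) : 'rV[R]_n :=
  match v with
  | inl i => delta R i
  | inr j => - delta R j
  end.

Definition bier_cone (R : realType) n (p : {set 'I_n} * {set 'I_n}) :
    set 'rV[R]_n :=
  [set x : 'rV[R]_n | exists a : label n -> R, (forall v, 0 <= a v) /\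
     x = \sum_(i in p.1) a (inl i) *: rho R (inl i)
         + \sum_(j in p.2) a (inr j) *: rho R (inr j)]%classic.
Arguments bier_cone R {n} p.

Definition bier_fan (R : realType) n (K : {set {set 'I_n}}) :
    set (set 'rV[R]_n) :=
  [set C | exists2 p, p \in bier K & C = bier_cone R p]%classic.
Arguments bier_fan R {n} K.

Definition convex_polytope (R : realType) n (P : set 'rV[R]_n) : Prop :=
  exists m (p : 'I_m -> 'rV[R]_n),
    P = [set x : 'rV[R]_n | exists a : 'I_m -> R,
          [/\ forall k, 0 <= a k, \sum_(k < m) a k = 1
            & x = \sum_(k < m) a k *: p k]]%classic.

(* v is a 0-dimensional face: {v} is cut out of P by a supporting hyperplane. *)
Definition polytope_vertex (R : realType) n (P : set 'rV[R]_n) (v : 'rV[R]_n) :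
    Prop :=
  exists (u : 'rV[R]_n) (c : R),
    (P `<=` [set x | dot u x <= c] /\
     P `&` [set x | dot u x = c] = [set v])%classic.

(* Linear functionals on H0 are identified with vectors of H0 through [dot]. *)
Definition outer_normal_cone (R : realType) n (P : set 'rV[R]_n)
    (v : 'rV[R]_n) : set 'rV[R]_n :=
  [set u | H0 u /\ (forall x, P x -> dot u x <= dot u v)]%classic.

Definition maximal_cones (R : realType) n (F : set (set 'rV[R]_n)) :
    set (set 'rV[R]_n) :=
  [set C | F C /\ (forall D, F D -> C `<=` D -> D = C)]%classic.

Definition is_normal_fan (R : realType) n (F : set (set 'rV[R]_n))
    (P : set 'rV[R]_n) : Prop :=
  [/\ convex_polytope P, (P `<=` H0)%classic
    & maximal_cones F
      = [set outer_normal_cone P v | v in [set v | polytope_vertex P v]]%classic].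

(* Only genuine vertices of Bier(K) contribute an inequality. *)
Definition P_of (R : realType) n (K : {set {set 'I_n}}) (f : label n -> R) :
    set 'rV[R]_n :=
  [set x | H0 x /\ (forall v, bier_vertex K v -> dot (rho R v) x <= f v)]%classic.

(* Neither [submodular] nor [P_of] depends on the value of f at a label that is
   not a vertex of Bier(K); functions on the vertex set are represented by
   functions vanishing at these labels. If all 2n labels are vertices, the last
   condition is vacuous. *)
Definition submodular_functions (R : realType) n (K : {set {set 'I_n}}) :
    set (label n -> R) :=
  [set f | submodular K f /\ (forall v, ~~ bier_vertex K v -> f v = 0)]%classic.
Arguments submodular_functions R {n} K.

(* Main.v *)
(** For a facet of Bier(K), recorded as (S, c) with T = [n] \ (S u {c}), let v be
    the point of H0 at which the inequalities of P_f labelled by S and T are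
    tight. Crossing a ridge moves v by a multiple of some e_a - e_b, and the
    multiplier [jump] is the difference of the two sides of the submodularity
    inequality of that ridge. So if f is K-submodular, the simplex algorithm run
    in direction u climbs to a facet whose cone contains u; hence the points v
    lie in P_f and have the facet cones as normal cones. A point of P_f with two
    slack coordinates a and b can be moved both ways along e_a - e_b, so P_f is
    the convex hull of these points. Conversely, if a polytope P has normal fan F,
    its vertices are the points v built from its support function h; along a ridge
    two distinct vertices differ by a positive multiple of e_a - e_b, so h is
    K-submodular and P = P_h. Finally P_f = P_h forces f = h at the vertices of
    Bier(K): at a vertex of P_h the coordinate c is slack, which leaves room to
    push the vertex out of P_h if f were larger than h. *)

Require Import Defs.
From mathcomp Require Import all_boot all_order all_algebra.
From mathcomp Require Import boolp classical_sets functions reals.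
From mathcomp Require Import zify ring lra.
Set Implicit Arguments.
Unset Strict Implicit.
Unset Printing Implicit Defensive.
Import Order.TTheory GRing.Theory Num.Theory.
Local Open Scope ring_scope.

(** * Coordinates, pairing and roots on the hyperplane [H0] *)

Section HyperplaneH0.
Variables (R : realType) (n : nat).
Implicit Types (x y u : 'rV[R]_n) (w : 'I_n -> R).

Lemma H0_eq_off x y c :
  H0 x -> H0 y -> (forall i, i != c -> x 0 i = y 0 i) -> x = y.
Proof.
rewrite /H0 /= => hx hy hxy; apply/rowP=> i.
have [->|/hxy//] := eqVneq i c.
have := etrans hx (esym hy); rewrite (bigD1 c)//= [RHS](bigD1 c)//=.
by rewrite (eq_bigr _ hxy); exact: addIr.
Qed.

(** A constant vector in [H0] is zero, so points of [H0] may be compared modulo the all-ones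
    vector. *)
Lemma H0_eq_shift x y d : (0 < n)%N ->
  H0 x -> H0 y -> (forall i, x 0 i = y 0 i + d) -> x = y.
Proof.
rewrite /H0 /= => n0 hx hy hxy; apply/rowP=> i.
suff d0 : d = 0 by rewrite hxy d0 addr0.
move: hx; rewrite (eq_bigr _ (fun i _ => hxy i)) big_split /= hy add0r.
rewrite sumr_const card_ord => /eqP; rewrite mulrn_eq0 => /orP[|/eqP//].
by rewrite eqn0Ngt n0.
Qed.

Lemma dotDr u x y : dot u (x + y) = dot u x + dot u y.
Proof. by rewrite /dot -big_split; apply: eq_bigr => i _; rewrite mxE mulrDr. Qed.

Lemma dotZr u t x : dot u (t *: x) = t * dot u x.
Proof. by rewrite /dot mulr_sumr; apply: eq_bigr => i _; rewrite mxE mulrCA. Qed.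

Lemma dot_sumr u (I : finType) (a : I -> R) (p : I -> 'rV[R]_n) :
  dot u (\sum_k a k *: p k) = \sum_k a k * dot u (p k).
Proof.
apply: (big_ind2 (fun x b => dot u x = b)) => [|x b y d <- <-|k _].
- by rewrite /dot big1 // => i _; rewrite mxE mulr0.
- exact: dotDr.
- exact: dotZr.
Qed.

(** Shifting [u] by a constant does not change its pairing with vectors of [H0]. With [c] the pivot
    of a facet, the signs of the factors [u 0 i - u 0 c] can be read off the cone of that facet. *)
Lemma dot_H0E u x y c : H0 x -> H0 y ->
  dot u x - dot u y = \sum_i (u 0 i - u 0 c) * (x 0 i - y 0 i).
Proof.
rewrite /H0 /dot /= => hx hy; under [RHS]eq_bigr do rewrite mulrBl !mulrBr.
by rewrite !sumrB -!mulr_sumr hx hy mulr0 subrr subr0.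
Qed.

(** The orthogonal projection of [w] onto [H0]; functionals are given by convenient weights and
    projected afterwards. *)
Definition center w : 'rV[R]_n := \row_i (w i - n%:R^-1 * \sum_j w j).

Lemma center_H0 w : (0 < n)%N -> H0 (center w).
Proof.
move=> n0; rewrite /H0 /=; under eq_bigr do rewrite mxE.
rewrite sumrB sumr_const card_ord -[X in _ - X]mulr_natl mulrA mulfV ?mul1r ?subrr //.
by rewrite pnatr_eq0 -lt0n.
Qed.

Lemma centerB w i j : center w 0 i - center w 0 j = w i - w j.
Proof. by rewrite !mxE; ring. Qed.

Lemma center_le w i j : (center w 0 i <= center w 0 j) = (w i <= w j).
Proof. by rewrite -subr_ge0 centerB subr_ge0. Qed.

Lemma dot_center w x : H0 x -> dot (center w) x = \sum_i w i * x 0 i.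
Proof.
rewrite /H0 /dot /= => hx; under eq_bigr do rewrite mxE mulrBl.
by rewrite sumrB -mulr_sumr hx mulr0 subr0.
Qed.

Lemma deltaE i : delta R i = center (fun k => (k == i)%:R).
Proof.
apply/rowP=> k; rewrite !mxE /=; congr (_ - _ * _).
rewrite summxE (bigD1 k)//= mxE !eqxx big1 ?addr0 => [|j /negPf jk].
  by rewrite (bigD1 i)//= eqxx big1 ?addr0 // => j /negPf ->.
by rewrite mxE eqxx /= eq_sym jk.
Qed.

Lemma opp_deltaE i : - delta R i = center (fun k => - (k == i)%:R).
Proof. by rewrite deltaE; apply/rowP=> k; rewrite !mxE sumrN; ring. Qed.

Lemma dot_delta i x : H0 x -> dot (delta R i) x = x 0 i.
Proof.
move=> hx; rewrite deltaE dot_center // (bigD1 i)//= eqxx mul1r big1 ?addr0 //.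
by move=> j /negPf ->; rewrite mul0r.
Qed.

Lemma dot_opp_delta i x : H0 x -> dot (- delta R i) x = - x 0 i.
Proof.
move=> hx; rewrite -dot_delta // /dot -sumrN; apply: eq_bigr => k _.
by rewrite mxE mulNr.
Qed.

Definition root_vec (a b : 'I_n) : 'rV[R]_n := delta_mx 0 a - delta_mx 0 b.

Lemma root_vecE a b i : root_vec a b 0 i = (i == a)%:R - (i == b)%:R.
Proof. by rewrite !mxE eqxx. Qed.

Lemma root_vec_H0 a b : H0 (root_vec a b).
Proof.
rewrite /H0 /=; under eq_bigr do rewrite root_vecE.
rewrite sumrB (bigD1 a)//= eqxx big1 ?addr0 => [|j /negPf -> //].
by rewrite (bigD1 b)//= eqxx big1 ?addr0 ?subrr // => j /negPf ->.
Qed.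

Lemma dot_root_vec u a b : dot u (root_vec a b) = u 0 a - u 0 b.
Proof.
rewrite /dot; under eq_bigr do rewrite root_vecE mulrBr.
rewrite sumrB (bigD1 a)//= eqxx mulr1 big1 ?addr0 => [|j /negPf ->].
  rewrite (bigD1 b)//= eqxx mulr1 big1 ?addr0 // => j /negPf ->.
  by rewrite mulr0.
by rewrite mulr0.
Qed.

Lemma H0D x y : H0 x -> H0 y -> H0 (x + y).
Proof.
rewrite /H0 /= => hx hy; under eq_bigr do rewrite mxE.
by rewrite big_split /= hx hy addr0.
Qed.

Lemma H0Z t x : H0 x -> H0 (t *: x).
Proof.
rewrite /H0 /= => hx; under eq_bigr do rewrite mxE.
by rewrite -mulr_sumr hx mulr0.
Qed.

End HyperplaneH0.

(** * Facets of Bier(K) and adjacency across ridges *)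

Section Facets.
Variables (n : nat) (K : {set {set 'I_n}}).
Hypothesis hK : simplicial_complex K.
Implicit Types (s : {set 'I_n} * 'I_n).

(* A facet (S, T) of Bier(K) is recorded as (S, c) with T = [n] \ (S u {c}). *)
Definition facet s : bool := (s.1 \in K) && (s.2 |: s.1 \notin K)%SET.

Lemma complexS (S T : {set 'I_n}) : T \subset S -> S \in K -> T \in K.
Proof. by case: hK => _; apply. Qed.

Lemma facet_notin s : facet s -> s.2 \notin s.1.
Proof.
by case/andP=> sK; apply: contra => cs; rewrite (finset.setUidPr _) // finset.sub1set.
Qed.

Lemma bier_vertex_inl i : K \proper [set: {set 'I_n}]%SET ->
  bier_vertex K (inl i) = ([set i]%SET \in K).
Proof.
case/properP=> _ [S _ SK].
rewrite /= !inE /= finset.setI0 eqxx andbT finset.setC0 andb_idr // => _.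
by apply: contra SK => /complexS; apply; exact: finset.subsetT.
Qed.

Lemma bier_vertex_inr j : bier_vertex K (inr j) = ((~: [set j])%SET \notin K).
Proof. by rewrite /= !inE /= finset.set0I eqxx andbT; case: hK => ->. Qed.

(** Take [S] largest in [K] between [A] and [B]. It is not [B], and adding any [c] of [B] outside
    [S] leaves [K]. This extends the simplex formed by [A] and the complement of [B] to a facet. *)
Lemma facet_of_chain (A B : {set 'I_n}) : A \in K -> B \notin K -> A \subset B ->
  exists s, [/\ facet s, A \subset s.1 & (s.2 |: s.1 \subset B)%SET].
Proof.
move=> AK BK AB.
have hA : (A \in K) && (A \subset A) && (A \subset B) by rewrite AK subxx AB.
pose inAB (S : {set 'I_n}) := (S \in K) && (A \subset S) && (S \subset B).
case: (@arg_maxnP _ A inAB (fun S => #|S|) hA) => S /andP[/andP[SK AS] SB] Smax.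
have /properP[_ [c cB cS]] : S \proper B.
  by rewrite finset.properEneq SB andbT; apply: contraNneq BK => <-.
have cSB : (c |: S \subset B)%SET by rewrite finset.subUset finset.sub1set cB.
exists (S, c); split=> //; rewrite /facet /= SK /=; apply/negP=> cSK.
have := Smax (c |: S)%SET; rewrite /inAB cSK cSB (fintype.subset_trans AS (finset.subsetUr _ _)).
by rewrite cardsU1 cS add1n => /(_ isT) /=; rewrite ltnn.
Qed.

Lemma exists_facet : K \proper [set: {set 'I_n}]%SET -> exists s, facet s.
Proof.
case/properP=> _ [B _ BK]; case: (hK) => K0 _.
by have [s []] := facet_of_chain K0 BK (finset.sub0set B); exists s.
Qed.

Lemma facet_inl s i : facet s -> i \in s.1 -> [set i]%SET \in K.
Proof. by case/andP=> sK _ is1; apply: complexS sK; rewrite finset.sub1set. Qed.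

Lemma facet_inr s i : facet s -> i \notin s.1 -> i != s.2 ->
  (~: [set i])%SET \notin K.
Proof.
case/andP=> _ sK is1 ic; apply: contra sK; apply: complexS.
by rewrite finset.subsetC finset.sub1set !inE negb_or ic.
Qed.

(** The other facet containing the ridge left when the label of [a] is dropped from [s]. That ridge
    misses [a] and the pivot [s.2]; membership in [K] decides which label is added and which index
    becomes the pivot. *)
Definition nbr s a : {set 'I_n} * 'I_n :=
  if a \in s.1 then
    if (s.2 |: s.1 :\ a \in K)%SET then (s.2 |: s.1 :\ a, a)%SET
    else (s.1 :\ a, s.2)%SET
  else if (a |: s.1 \in K)%SET then (a |: s.1, s.2)%SET else (s.1, a).

Lemma facet_nbr s a : facet s -> a != s.2 -> facet (nbr s a).
Proof.
move=> /[dup] /facet_notin cs /andP[sK csK] ac; rewrite /nbr.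
case: ifPn => as1; case: ifPn => h; rewrite /facet /= ?h ?andbT //=.
- by rewrite finset.setUCA finset.setD1K // csK.
- by apply: complexS sK; exact: finset.subD1set.
- by apply: contra csK; apply: complexS; rewrite finset.setUCA finset.subsetUr.
Qed.

Lemma nbr_neq s a : facet s -> a != s.2 -> nbr s a != s.
Proof.
move=> /facet_notin cs ac; rewrite /nbr; case: s cs ac => S c /= cs ac.
case: ifPn => aS; case: ifPn => h; apply/eqP; case.
- by move=> _ e; rewrite e eqxx in ac.
- by move=> e; move: aS; rewrite -e !inE eqxx.
- by move=> e; move: aS; rewrite -e !inE eqxx.
- by move=> e; rewrite e eqxx in ac.
Qed.

End Facets.

(** * Vertices attached to facets, and their change across ridges *)

Section Ridges.
Variables (R : realType) (n : nat) (K : {set {set 'I_n}}).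
Hypothesis hK : simplicial_complex K.
Implicit Types (s : {set 'I_n} * 'I_n) (f : label n -> R).

(** Trades the cardinality condition of a ridge for [c1] and [c2] lying outside [X]. *)
Lemma ridge_XYP (X : {set 'I_n}) c1 c2 : ridge_XY K X (X :|: [set c1; c2])%SET c1 c2 <->
  [/\ X \in K, (c1 |: (c2 |: X))%SET \notin K, c1 \notin X, c2 \notin X & c1 != c2].
Proof.
have YE : (X :|: [set c1; c2] = c1 |: (c2 |: X))%SET.
  by rewrite finset.setUC -finset.setUA.
rewrite YE; split=> [[[]]|[XK YK c1X c2X c12]].
  rewrite !inE /= finset.setCK => /and3P[XK YK _] cardXY _ c12.
  (* The subtraction [n - 2] is truncated; two distinct indices make it exact. *)
  have n2 : (2 <= n)%N.
    by have := max_card [set c1; c2]%SET; rewrite cards2 c12 card_ord.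
  have := cardsC (c1 |: (c2 |: X)); rewrite card_ord.
  rewrite !cardsU1 !inE (negPf c12) /= => cardY.
  by split=> //; apply/negP=> cX; move: cardY cardXY; rewrite cX /=;
    [case: (c2 \in X)|case: (c1 \in X)] => /=; lia.
have := cardsC (c1 |: (c2 |: X)); rewrite card_ord !cardsU1 !inE (negPf c12).
rewrite c1X c2X /= => cardY; split=> //.
split=> /=; last by move: cardY => /=; lia.
rewrite !inE /= finset.setCK XK YK /= finset.setUA finset.setCU.
by apply/eqP/setP=> i; rewrite !inE; case: (i \in X); rewrite ?andbF.
Qed.

(** The tight inequalities prescribe every coordinate except the pivot, which is then forced by the
    zero coordinate sum. *)
Definition vert f s : 'rV[R]_n :=
  let w i := if i \in s.1 then f (inl i) else - f (inr i) in
  \row_i (if i == s.2 then - \sum_(j | j != s.2) w j else w i).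

Lemma vert_H0 f s : H0 (vert f s).
Proof.
rewrite /H0 /= (bigD1 s.2)//= mxE eqxx addrC.
by apply/eqP; rewrite subr_eq0; apply/eqP/eq_bigr => i /negPf h; rewrite mxE h.
Qed.

Lemma vert_inl f s i : facet K s -> i \in s.1 -> vert f s 0 i = f (inl i).
Proof.
move=> /facet_notin cs is1; rewrite mxE is1; case: eqVneq => // ic.
by rewrite -ic is1 in cs.
Qed.

Lemma vert_inr f s i : i \notin s.1 -> i != s.2 -> vert f s 0 i = - f (inr i).
Proof. by move=> /negPf is1 /negPf ic; rewrite mxE ic is1. Qed.

Lemma vert_pivot f s : facet K s -> vert f s 0 s.2 =
  \sum_(j | j \notin (s.2 |: s.1)%SET) f (inr j) - \sum_(i in s.1) f (inl i).
Proof.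
move=> /facet_notin cs; rewrite mxE eqxx (bigID (mem s.1))/= opprD addrC; congr (_ + _).
  rewrite -sumrN; apply: eq_big => [i|i /andP[_ /negPf ->]]; last exact: opprK.
  by rewrite !inE negb_or.
congr (- _); apply: eq_big => [i|i /andP[_ ->] //].
by apply: andb_idl; apply: contraTneq => ->.
Qed.

(** The branches are the Lambda-, X- and V-configuration. The last one needs no second test: if
    [a |: X] is not in [K], then [a] is not in [s.1], so [X = s.1] and [s.2 |: X] is not in [K]
    either. *)
Definition jump f s a : R :=
  let X := (s.1 :\ a)%SET in
  let Y := (X :|: [set a; s.2])%SET in
  if (a |: X \in K)%SET then
    if (s.2 |: X \in K)%SET then
      f (inl a) + f (inl s.2) + \sum_(i in X) f (inl i)
      - \sum_(j | j \notin Y) f (inr j)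
    else f (inl a) + f (inr a)
  else f (inr a) + f (inr s.2) + \sum_(j | j \notin Y) f (inr j)
       - \sum_(i in X) f (inl i).

(** Oriented so that the inequality of the dropped label becomes slack; those of the other labels of
    [s] stay tight. *)
Definition edge s a : 'rV[R]_n :=
  if a \in s.1 then root_vec R s.2 a else root_vec R a s.2.

Lemma setD1_id (S : {set 'I_n}) a : a \notin S -> (S :\ a = S)%SET.
Proof.
by move=> aS; apply/setP=> i; rewrite !inE andb_idl // => iS;
  apply: contraNneq aS => <-.
Qed.

(** Both sides lie in [H0] and agree away from [a] and [s.2], so a single further coordinate has to
    be compared. *)
Lemma vert_nbr f s a : facet K s -> a != s.2 ->
  vert f (nbr K s a) = vert f s + jump f s a *: edge s a.
Proof.
move=> /[dup] fs /[dup] /facet_notin cs /andP[sK csK] ac.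
have fns := facet_nbr hK fs ac; have cna : s.2 != a by rewrite eq_sym.
have HD : H0 (vert f s + jump f s a *: edge s a).
  by apply: H0D (vert_H0 _ _) (H0Z _ _); rewrite /edge; case: ifP => _; exact: root_vec_H0.
have HV := vert_H0 f (nbr K s a).
have sumE i : (vert f s + jump f s a *: edge s a) 0 i
    = vert f s 0 i + jump f s a * edge s a 0 i.
  by rewrite mxE [X in _ + X]mxE.
have edgeE i : i != a -> i != s.2 -> edge s a 0 i = 0.
  by move=> /negPf ia /negPf ic; rewrite /edge; case: ifP; rewrite root_vecE ia ic subrr.
have other i : i != a -> i != s.2 ->
    vert f (nbr K s a) 0 i = (vert f s + jump f s a *: edge s a) 0 i.
  move=> ia ic; rewrite sumE edgeE // mulr0 addr0.
  have [is1|is1] := boolP (i \in s.1).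
    rewrite !(vert_inl _ _) // /nbr; by do ![case: ifP] => _ _;
      rewrite ?inE ?ia ?is1 ?orbT.
  rewrite !vert_inr // /nbr; by do ![case: ifP] => _ _ //=;
    rewrite ?inE ?(negPf ic) ?(negPf ia) ?(negPf is1).
(* If the pivot stays, [a] switches between its two labels, and coordinate [a] is compared. *)
have [Q|Q] := boolP ((nbr K s a).2 == s.2).
  apply: (H0_eq_off (c := s.2)) => // i ic; have [->{i ic}|ia] := eqVneq i a; last exact: other.
  rewrite sumE; move: Q fns; rewrite /nbr /edge /jump; case: ifPn => as1.
    case: ifPn => [_ /=|h _ fns]; first by rewrite (negPf ac).
    rewrite finset.setD1K // sK.
    rewrite vert_inr ?inE ?eqxx // vert_inl // root_vecE eqxx (negPf ac) /=; ring.
  rewrite setD1_id //; case: ifPn => [aK _ fns|_ /=]; last by rewrite (negPf ac).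
  rewrite (negPf csK) vert_inl ?inE ?eqxx // vert_inr //.
  rewrite root_vecE eqxx (negPf ac) /=; ring.
(* Here [a] becomes the pivot. Coordinate [s.2] is now prescribed by [f]; its old value comes from
   [vert_pivot]. *)
apply: (H0_eq_off (c := a)) => // i ia; have [->{i ia}|ic] := eqVneq i s.2; last exact: other.
rewrite sumE vert_pivot //; move: Q fns; rewrite /nbr /edge /jump; case: ifPn => as1.
  case: ifPn => [cK _ fns|h /=]; last by rewrite eqxx.
  rewrite finset.setD1K // sK vert_inl ?inE ?eqxx // root_vecE eqxx (negPf cna) /=.
  rewrite (big_setD1 a as1) /= subr0 mulr1.
  have -> : \sum_(j | j \notin (s.1 :\ a :|: [set a; s.2])%SET) f (inr j)
      = \sum_(j | j \notin (s.2 |: s.1)%SET) f (inr j); last by ring.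
    apply: eq_bigl => j.
    rewrite !inE; have [->|] := eqVneq j a; first by rewrite as1 orbT.
  by rewrite /= orbC.
rewrite setD1_id //; case: ifPn => [_ /=|aK _ fns]; first by rewrite eqxx.
rewrite vert_inr //= ?root_vecE ?eqxx ?(negPf cna) //=.
rewrite (bigD1 a) /=; last by rewrite !inE negb_or ac.
have -> : \sum_(j | j \notin (s.1 :|: [set a; s.2])%SET) f (inr j)
    = \sum_(i | (i \notin (s.2 |: s.1)%SET) && (i != a)) f (inr i); last by ring.
apply: eq_bigl => j; rewrite !inE.
by case: (j \in _); case: (j == a); case: (j == s.2).
Qed.

(** Puts the three families of inequalities into the form used by the simplex algorithm, one
    condition per facet and dropped label. *)
Lemma submodularP f :
  submodular K f <-> forall s a, facet K s -> a != s.2 -> 0 < jump f s a.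
Proof.
split=> [[L V X] s a fs ac|jp].
  have /andP[sK csK] := fs; have cs := facet_notin fs.
  have Ycs : (a |: (s.2 |: s.1 :\ a) \notin K)%SET.
    apply: contra csK; apply: (complexS hK); apply/fintype.subsetP=> i; rewrite !inE.
    by case: (i == a); case: (i == s.2).
  have XK : (s.1 :\ a \in K)%SET by apply: complexS sK => //; exact: finset.subD1set.
  have rXY : ridge_XY K (s.1 :\ a) (s.1 :\ a :|: [set a; s.2])%SET a s.2.
    by apply/ridge_XYP; split=> //; rewrite !inE ?eqxx // (negPf cs) andbF.
  rewrite /jump; case: ifPn => aK; first case: ifPn => cK.
  - by rewrite subr_gt0; exact: L.
  - by apply: X; split; eassumption.
  - rewrite subr_gt0; apply: V; split; [eassumption|exact: aK|].
    have as1 : a \notin s.1 by apply: contra aK => as1; rewrite finset.setD1K.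
    by rewrite setD1_id.
(* Each ridge is realized by dropping [c1] from a facet with pivot [c2]: from [(c1 |: X, c2)] for
   Lambda, from [(X, c2)] for V and X. *)
split=> X Y c1 c2 [/[dup] [[_ -> _]] /ridge_XYP[XK YK c1X c2X c12] c1K c2K].
- have := jp (c1 |: X, c2)%SET c1; rewrite /facet /jump /= setU1K // c1K c2K.
  by rewrite finset.setUCA YK => /(_ isT c12); rewrite subr_gt0.
- have c21 : c2 != c1 by rewrite eq_sym.
  have := jp (X, c2)%SET c1; rewrite /facet /jump /= setD1_id // c2K XK (negPf c1K).
  by move=> /(_ isT c12); rewrite subr_gt0.
- have := jp (X, c2)%SET c1; rewrite /facet /jump /= setD1_id // (negPf c2K) c1K XK.
  exact.
Qed.

End Ridges.

(** * The cones of the fan in terms of coordinate inequalities *)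

Section Cones.
Variables (R : realType) (n : nat) (K : {set {set 'I_n}}).
Hypotheses (hK : simplicial_complex K) (n0 : (0 < n)%N).
Implicit Types (s : {set 'I_n} * 'I_n) (u : 'rV[R]_n).

(** Modulo the all-ones vector, a combination of the rays of a facet is nonnegative on [S], zero at
    the pivot and nonpositive on [T]. Comparing with [u 0 s.2] removes the unknown shift. *)
Definition facet_cone s : set 'rV[R]_n :=
  [set u | H0 u /\ forall i,
    if i \in s.1 then u 0 s.2 <= u 0 i else u 0 i <= u 0 s.2]%classic.

(** The sum of the rays of the facet. *)
Definition facet_interior s : 'rV[R]_n :=
  center (fun i => if i == s.2 then 0 else if i \in s.1 then 1 else -1).

Lemma facet_interior_in s : facet K s -> facet_cone s (facet_interior s).
Proof.
move=> /facet_notin cs; split=> [|i]; first exact: center_H0.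
case: ifPn => is1; rewrite center_le eqxx ?is1 ?(negPf is1).
  by case: eqVneq.
by case: eqVneq => // _; rewrite lerN10.
Qed.

(** Once the pivots agree, the values 1, 0, -1 recover the facet. If [s'.2] were in [s.1], then
    [s'.2 |: s'.1] would lie inside [s.1]; if it had value -1, then [s.2 |: s.1] would lie inside
    [s'.1]. Either puts a non-member into [K]. *)
Lemma facet_interior_inj s s' : facet K s -> facet K s' ->
  facet_cone s' (facet_interior s) -> s' = s.
Proof.
move=> /[dup] /facet_notin cs /andP[sK csK] /[dup] /facet_notin cs' /andP[sK' csK'].
case=> _ hs.
have c'c : s'.2 = s.2.
  apply/eqP/negPn/negP => c'c.
  have [c'S|c'S] := boolP (s'.2 \in s.1).
    move/negP: csK'; apply; apply: (complexS hK _ sK); rewrite finset.subUset finset.sub1set c'S.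
    apply/fintype.subsetP => i is'; move: (hs i); rewrite is' center_le (negPf c'c) c'S.
    by case: ifP => _; [rewrite ler10|case: ifP => // _ /(le_trans ler01); rewrite ler0N1].
  move/negP: csK; apply; apply: (complexS hK _ sK').
  apply/fintype.subsetP => i; rewrite !inE => iS; apply/negPn/negP => is'.
  move: (hs i); rewrite (negPf is') center_le (negPf c'c) (negPf c'S).
  by case: (i == s.2) iS => [_|/= ->]; rewrite ?ler0N1 // => /(le_trans ler01); rewrite ler0N1.
rewrite [s']surjective_pairing [s]surjective_pairing c'c; congr (_, _).
apply/setP=> i; move: (hs i); rewrite c'c !center_le eqxx.
have [->|ic] := eqVneq i s.2; first by rewrite (negPf cs) -c'c (negPf cs').
by case: (i \in s'.1); case: (i \in s.1) ; rewrite ?ler10 ?ler0N1.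
Qed.

(** The number [d] is the shift by the all-ones vector caused by projecting to [H0]; on indices
    outside both sets the coordinate equals [d]. *)
Lemma bier_coneP (p : {set 'I_n} * {set 'I_n}) u : (p.1 :&: p.2 = finset.set0)%SET ->
  bier_cone R p u <-> H0 u /\ exists d, forall i,
    (i \notin p.2 -> d <= u 0 i) /\ (i \notin p.1 -> u 0 i <= d).
Proof.
move=> p12.
have p12N i : i \in p.1 -> i \in p.2 -> False.
  by move=> h1 h2; have := finset.in_set0 i; rewrite -p12 inE h1 h2.
pose comb (a : label n -> R) := \sum_(i in p.1) a (inl i) *: rho R (inl i)
  + \sum_(j in p.2) a (inr j) *: rho R (inr j).
pose w a i := (if i \in p.1 then a (inl i) else 0) - (if i \in p.2 then a (inr i) else 0) : R.
have combE a : comb a = center (w a).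
  have H0s (I : finType) (P : pred I) (F : I -> 'rV[R]_n) :
      (forall i, H0 (F i)) -> H0 (\sum_(i | P i) F i).
    move=> hF; apply: (big_ind (fun x => H0 x)) => //; last exact: H0D.
    by rewrite /H0 /= big1 // => i _; rewrite mxE.
  (* Only the independence of this constant from the coordinate matters; it collects the projection
     terms of both sides. *)
  apply: (@H0_eq_shift _ _ _ _ (n%:R^-1 * (\sum_j w a j)
    - n%:R^-1 * (\sum_(i in p.1) a (inl i))
    + n%:R^-1 * \sum_(i in p.2) a (inr i))) => //.
  - by apply: H0D; apply: H0s => i; apply: H0Z;
      rewrite /= ?opp_deltaE ?deltaE; exact: center_H0.
  - exact: center_H0.
  move=> k; rewrite mxE !summxE.
  rewrite (eq_bigr (fun i => a (inl i) * (k == i)%:R - n%:R^-1 * a (inl i))); last first.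
    move=> i _; rewrite mxE /= deltaE mxE (bigD1 i)//= eqxx big1 ?addr0 => [|j /negPf -> //].
    by rewrite mulr1; ring.
  rewrite [X in _ + X](eq_bigr
    (fun i => - (a (inr i) * (k == i)%:R) + n%:R^-1 * a (inr i))); last first.
    move=> i _; rewrite mxE /= opp_deltaE mxE (bigD1 i)//= eqxx.
    rewrite big1 ?addr0 => [|j /negPf -> //]; last by rewrite oppr0.
    by rewrite mulrN1; ring.
  rewrite sumrB big_split /= -!mulr_sumr sumrN mxE.
  have pick (A : {set 'I_n}) (g : 'I_n -> R) :
      \sum_(i in A) g i * (k == i)%:R = if k \in A then g k else 0.
    case: ifPn => kA.
      rewrite (bigD1 k)//= eqxx mulr1 big1 ?addr0 // => i /andP[_ /negPf ik].
      by rewrite eq_sym ik mulr0.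
    rewrite big1 // => i iA; case: eqVneq => [e|_]; last by rewrite mulr0.
    by rewrite e iA in kA.
  rewrite !pick [w a k]/w; set W := \sum_(_ <- _) w _ _.
  move: W (if _ then _ else _) (if k \in p.2 then _ else _) => W b1 b2.
  by move: (\sum_(_ in p.1) _) (\sum_(_ in p.2) _) (n%:R^-1) => *; ring.
split=> [[a [a0 ->]]|[hu [d hd]]]; rewrite -?/(comb a).
  rewrite combE; split; first exact: center_H0.
  exists (- (n%:R^-1 * \sum_j w a j)) => i.
  rewrite !mxE -[X in X <= _]add0r -[X in _ /\ (_ -> _ <= X)]add0r.
  rewrite !lerD2r /w; split=> /negPf ->; rewrite ?subr0 ?sub0r ?oppr_le0; by case: ifP.
(* The coefficients are the positive and negative parts of [u - d]. *)
pose a (v : label n) : R := match v with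
  | inl i => Num.max 0 (u 0 i - d) | inr i => Num.max 0 (d - u 0 i) end.
exists a; split=> [[] i|]; rewrite ?le_max ?lexx // -/(comb a) combE.
apply: (@H0_eq_shift _ _ _ _ (d + n%:R^-1 * \sum_j (u 0 j - d))) => //; first exact: center_H0.
have wE i : w a i = u 0 i - d.
  rewrite /w /a; have [h1 h2] := hd i.
  have [i1|i1] := boolP (i \in p.1); have [i2|i2] := boolP (i \in p.2).
  - by case: (p12N i).
  - by rewrite subr0 max_r // subr_ge0 h1.
  - by rewrite sub0r max_r ?opprB // subr_ge0 h2.
  - by rewrite subrr; apply/esym/eqP; rewrite subr_eq0 eq_le h1 ?h2.
by move=> i; rewrite mxE (eq_bigr _ (fun j _ => wE j)) wE; ring.
Qed.

Lemma facet_cone_bier s : facet K s ->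
  exists2 p, p \in bier K & facet_cone s = bier_cone R p.
Proof.
move=> /[dup] /facet_notin cs /andP[sK csK].
have p12 : ((s.1, ~: (s.2 |: s.1)).1 :&: (s.1, ~: (s.2 |: s.1)).2 = finset.set0)%SET.
  by apply/setP => i; rewrite !inE /= negb_or; case: (i \in s.1); rewrite ?andbF.
exists (s.1, ~: (s.2 |: s.1))%SET; first by rewrite !inE /= finset.setCK sK csK; apply/eqP.
apply/seteqP; split=> u; rewrite bier_coneP //= => -[hu].
  move=> h; split=> //; exists (u 0 s.2) => i; move: (h i); rewrite !inE negbK.
  by case: ifPn => is1 hi; split=> //; rewrite orbF => /eqP ->.
case=> d hd; split=> // i.
have dE : u 0 s.2 = d.
  by apply/eqP; rewrite eq_le; have [h1 h2] := hd s.2; rewrite h1 ?h2 // !inE eqxx.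
have [h1 h2] := hd i; rewrite dE; case: ifPn => // is1.
by apply: h1; rewrite !inE is1 orbT.
Qed.

(** A facet squeezed between [p.1] and the complement of [p.2] has its pivot outside both sets, so
    [d] is the pivot coordinate. *)
Lemma bier_cone_sub (p : {set 'I_n} * {set 'I_n}) : p \in bier K ->
  exists2 s, facet K s & (bier_cone R p `<=` facet_cone s)%classic.
Proof.
rewrite !inE => /and3P[p1 p2 /eqP p12].
have p1p2 : (p.1 \subset ~: p.2)%SET.
  by rewrite -finset.disjoints_subset -finset.setI_eq0 p12.
have [s [fs ps sp]] := facet_of_chain p1 p2 p1p2.
exists s => // u /bier_coneP[//|hu [d hd]]; split=> // i.
have cs := facet_notin fs.
have cp1 : s.2 \notin p.1 by apply: contra cs; exact/fintype.subsetP.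
have cp2 : s.2 \notin p.2.
  by have /fintype.subsetP/(_ s.2) := sp; rewrite !inE eqxx => /(_ isT).
have dE : u 0 s.2 = d by apply/eqP; rewrite eq_le; have [h1 h2] := hd s.2; rewrite h1 ?h2.
have [h1 h2] := hd i; rewrite dE; case: ifPn => is1.
  by apply: h1; have /fintype.subsetP/(_ i) := sp; rewrite !inE is1 orbT => /(_ isT).
by apply: h2; apply: contra is1; exact/fintype.subsetP.
Qed.

Lemma maximal_cones_bier : maximal_cones (bier_fan R K) =
  [set facet_cone s | s in [set s | facet K s]]%classic.
Proof.
apply/seteqP; split=> C.
  case=> -[p /bier_cone_sub[s fs ps] ->] Cmax; exists s => //.
  by apply: Cmax => //; have [q qK ->] := facet_cone_bier fs; exists q.
case=> s /= fs <-; split; first by have [q qK ->] := facet_cone_bier fs; exists q.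
move=> D [p /bier_cone_sub[s' fs' ps'] ->] sp.
have e : s' = s by apply: facet_interior_inj => //; apply/ps'/sp/facet_interior_in.
by apply/seteqP; split=> //; rewrite -e.
Qed.

End Cones.

(** * The polytope [P_of K f], its vertices and normal cones *)

Section SubmodularPolytope.
Variables (R : realType) (n : nat) (K : {set {set 'I_n}}).
Hypotheses (hK : simplicial_complex K) (hKp : K \proper [set: {set 'I_n}]%SET).
Hypothesis n0 : (0 < n)%N.
Implicit Types (s : {set 'I_n} * 'I_n) (u x : 'rV[R]_n) (f : label n -> R).

Lemma P_ofP f x : P_of K f x <-> [/\ H0 x,
  forall i, [set i]%SET \in K -> x 0 i <= f (inl i)
  & forall j, (~: [set j])%SET \notin K -> - f (inr j) <= x 0 j].
Proof.
split=> [[hx h]|[hx h1 h2]].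
  split=> // [i|j] hi.
    by have := h (inl i); rewrite bier_vertex_inl // dot_delta //; exact.
  by have := h (inr j); rewrite bier_vertex_inr // dot_opp_delta // lerNl; exact.
split=> // -[i|j]; rewrite ?bier_vertex_inl ?bier_vertex_inr // => hi.
  by rewrite dot_delta //; exact: h1.
by rewrite dot_opp_delta // lerNl; exact: h2.
Qed.

Definition convex_set (Q : set 'rV[R]_n) := forall x y t,
  Q x -> Q y -> 0 <= t -> t <= 1 -> Q (t *: x + (1 - t) *: y).

(** Weak duality: in [dot_H0E] taken at the pivot, every summand is a product of factors of opposite
    sign or zero. *)
Lemma facet_cone_vert_max f s u x : facet K s -> facet_cone s u -> P_of K f x ->
  dot u x <= dot u (vert f s).
Proof.
move=> fs [_ hu] /P_ofP[hx h1 h2].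
rewrite -subr_le0 (dot_H0E _ s.2) //; last exact: vert_H0.
apply: sumr_le0 => i _; have := hu i; case: ifPn => is1 ui.
  rewrite (vert_inl _ fs) //; apply: mulr_ge0_le0; rewrite ?subr_ge0 ?subr_le0 //.
  by apply: h1; exact: facet_inl is1.
have [->|ic] := eqVneq i s.2; first by rewrite subrr mul0r.
rewrite vert_inr //; apply: mulr_le0_ge0; rewrite ?subr_ge0 ?subr_le0 //.
by apply: h2; exact: facet_inr is1 ic.
Qed.

(** A sum of nonnegative terms that is at most 0 vanishes termwise. This gives uniqueness of
    maximizers for weights that are zero only at [c]. *)
Lemma H0_eq_weighted (w : 'I_n -> R) c x y : H0 x -> H0 y -> w c = 0 ->
  (forall i, i != c -> w i != 0 /\ 0 <= w i * (x 0 i - y 0 i)) ->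
  dot (center w) x <= dot (center w) y -> x = y.
Proof.
move=> hx hy wc hw; rewrite !dot_center // -subr_le0 -sumrB.
under eq_bigr do rewrite -mulrBr; move=> le0.
have F0 i : 0 <= w i * (x 0 i - y 0 i).
  by have [->|/hw[]//] := eqVneq i c; rewrite wc mul0r.
have /eqP : \sum_i w i * (x 0 i - y 0 i) = 0 by apply/eqP; rewrite eq_le le0 sumr_ge0.
rewrite psumr_eq0 // => /allP F_eq0.
apply: (H0_eq_off (c := c)) => // i /hw[wi _].
have := F_eq0 i; rewrite mem_index_enum => /(_ isT) /=.
by rewrite mulf_eq0 (negPf wi) subr_eq0 => /eqP.
Qed.

Lemma facet_interior_max_uniq f s x : facet K s -> P_of K f x ->
  dot (facet_interior R s) (vert f s) <= dot (facet_interior R s) x ->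
  x = vert f s.
Proof.
move=> fs /P_ofP[hx h1 h2] le; apply/esym.
apply: (H0_eq_weighted (c := s.2) (vert_H0 _ _)) le; rewrite ?eqxx // => i ic.
rewrite (negPf ic); case: ifPn => is1.
  rewrite oner_eq0 mul1r (vert_inl _ fs) // subr_ge0; split=> //.
  by apply: h1; exact: facet_inl is1.
rewrite oppr_eq0 oner_eq0 mulN1r opprB vert_inr // subr_ge0; split=> //.
by apply: h2; exact: facet_inr is1 ic.
Qed.

(** Otherwise [i] is the pivot and [s.1] is empty, so that [s.2 |: s.1] is the singleton of [i], a
    member of [K]. *)
Lemma delta_cone_facet i s : [set i]%SET \in K -> facet K s ->
  facet_cone s (delta R i) -> i \in s.1.
Proof.
move=> iK /andP[_ csK] [_ h]; apply/negPn/negP=> is1.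
have ic : i = s.2.
  have := h i; rewrite (negPf is1) deltaE center_le eqxx.
  by case: eqVneq => // _; rewrite ler10.
have S0 k : k \notin s.1.
  apply/negP=> ks; have := h k; rewrite ks -ic deltaE center_le eqxx.
  by case: eqVneq => [e|_]; [rewrite e (negPf is1) in ks|rewrite ler10].
move/negP: csK; apply; rewrite -ic (_ : (_ |: _)%SET = [set i]%SET) //.
by apply/setP=> k; rewrite !inE (negPf (S0 k)) orbF.
Qed.

(** Dually, if [i] were the pivot, [s.1] would be the whole complement of [i]. *)
Lemma opp_delta_cone_facet i s : (~: [set i])%SET \notin K -> facet K s ->
  facet_cone s (- delta R i) -> i \notin s.1 /\ i != s.2.
Proof.
move=> iK /[dup] /facet_notin cs /andP[sK _] [_ h].
have is1 : i \notin s.1.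
  apply/negP=> is1; have := h i; rewrite is1 opp_deltaE center_le eqxx.
  case: eqVneq => [e|_]; first by rewrite e is1 in cs.
  by rewrite oppr0 ler0N1.
split=> //; apply/eqP=> ic; move/negP: iK; apply.
rewrite (_ : (~: [set i])%SET = s.1) //; apply/setP=> k; rewrite !inE.
have [->|ki] := eqVneq k i; first by rewrite (negPf is1).
have := h k; case: ifP => // _; rewrite -ic opp_deltaE center_le eqxx (negPf ki).
by rewrite oppr0 ler0N1.
Qed.

Definition tight f x i : bool :=
  (([set i]%SET \in K) && (x 0 i == f (inl i))) ||
  (((~: [set i])%SET \notin K) && (x 0 i == - f (inr i))).

(** Take for [t] the smaller of the slack above at [a] and the slack below at [b]; at least one of
    these bounds is present. *)
Lemma push f x a b : P_of K f x -> a != b ->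
  ([set a]%SET \in K -> x 0 a < f (inl a)) ->
  ((~: [set b])%SET \notin K -> - f (inr b) < x 0 b) ->
  exists t, [/\ 0 < t, P_of K f (x + t *: root_vec R a b)
    & tight f (x + t *: root_vec R a b) a || tight f (x + t *: root_vec R a b) b].
Proof.
move=> /P_ofP[hx h1 h2] ab ta tb.
have up_gt : [set a]%SET \in K -> 0 < f (inl a) - x 0 a.
  by move=> aK; rewrite subr_gt0 ta.
have lo_gt : (~: [set b])%SET \notin K -> 0 < x 0 b + f (inr b).
  by move=> bK; rewrite -[f (inr b)]opprK subr_gt0 tb.
have [t [t0 tup tlo tt]] : exists t, [/\ 0 < t,
    [set a]%SET \in K -> t <= f (inl a) - x 0 a,
    (~: [set b])%SET \notin K -> t <= x 0 b + f (inr b)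
    & ([set a]%SET \in K /\ t = f (inl a) - x 0 a) \/
      ((~: [set b])%SET \notin K /\ t = x 0 b + f (inr b))].
  have [aK|aK] := boolP ([set a]%SET \in K);
    have [bK|bK] := boolP ((~: [set b])%SET \in K).
  - by exists (f (inl a) - x 0 a); split=> //; [exact: up_gt|left].
  - have ua := up_gt aK; have lb := lo_gt bK.
    have [le|/ltW le] := leP (f (inl a) - x 0 a) (x 0 b + f (inr b)).
      by exists (f (inl a) - x 0 a); split=> //; left.
    by exists (x 0 b + f (inr b)); split=> //; right.
  (* Both bounds cannot be absent: since [a != b], the singleton of [a] is contained in the
     complement of [b]. *)
  - move/negP: aK => []; apply: (complexS hK _ bK).
    by rewrite finset.sub1set !inE.
  - by exists (x 0 b + f (inr b)); split=> //; [exact: lo_gt|right].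
have yE i : (x + t *: root_vec R a b) 0 i = x 0 i + t * ((i == a)%:R - (i == b)%:R).
  by rewrite mxE [X in _ + X]mxE root_vecE.
have ba : b != a by rewrite eq_sym.
have ya : (x + t *: root_vec R a b) 0 a = x 0 a + t.
  by rewrite yE eqxx (negPf ab) subr0 mulr1.
have yb : (x + t *: root_vec R a b) 0 b = x 0 b - t.
  by rewrite yE eqxx (negPf ba) sub0r mulrN1.
have yo i : i != a -> i != b -> (x + t *: root_vec R a b) 0 i = x 0 i.
  by move=> /negPf ia /negPf ib; rewrite yE ia ib subrr mulr0 addr0.
exists t; split=> //.
  apply/P_ofP; split=> [|i iK|i iK].
  - by apply: H0D => //; apply: H0Z; exact: root_vec_H0.
  - move: iK; have [->|ia] := eqVneq i a => iK; first by rewrite ya; have := tup iK; lra.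
    move: iK; have [->|ib] := eqVneq i b => iK; last by rewrite yo // h1.
    by rewrite yb; have := h1 _ iK; lra.
  - move: iK; have [->|ia] := eqVneq i a => iK; first by rewrite ya; have := h2 _ iK; lra.
    move: iK; have [->|ib] := eqVneq i b => iK; last by rewrite yo // h2.
    by rewrite yb; have := tlo iK; lra.
case: tt => -[k te]; apply/orP; [left|right]; apply/orP; [left|right].
  by rewrite k ya te; apply/eqP; ring.
by rewrite k yb te; apply/eqP; ring.
Qed.

Lemma ntight_lt f x i : P_of K f x -> ~~ tight f x i ->
  ([set i]%SET \in K -> x 0 i < f (inl i)) /\
  ((~: [set i])%SET \notin K -> - f (inr i) < x 0 i).
Proof.
move=> /P_ofP[_ h1 h2]; rewrite /tight negb_or => /andP[ti1 ti2].
split=> iK; move: ti1 ti2; rewrite iK /= => ti1 ti2; rewrite lt_neqAle.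
  by rewrite ti1 h1.
by rewrite eq_sym ti2 h2.
Qed.

Section Fixed.
Variable f : label n -> R.
Hypothesis fsub : submodular K f.

(* An edge of the simplex algorithm. *)
Lemma improve s u : facet K s -> H0 u -> ~ facet_cone s u ->
  exists2 s', facet K s' & dot u (vert f s) < dot u (vert f s').
Proof.
move=> fs hu nsu.
have /forallPn[a] : ~~ [forall i, if i \in s.1 then u 0 s.2 <= u 0 i else u 0 i <= u 0 s.2].
  by apply/negP => /forallP h; apply: nsu; split.
have [->|ac] := eqVneq a s.2; first by rewrite !lexx if_same.
move=> ha; have j0 := (submodularP hK f).1 fsub s a fs ac.
(* The violated inequality at [a] says exactly that [u] increases along [edge s a]. *)
exists (nbr K s a); first exact: facet_nbr.
rewrite vert_nbr // dotDr dotZr ltrDl mulr_gt0 // /edge.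
by case: ifP ha => _; rewrite -ltNge dot_root_vec subr_gt0.
Qed.

(** Termination of the simplex algorithm: there are finitely many facets, and one of best value
    cannot be improved. *)
Lemma exists_max_vert u : H0 u -> exists s, [/\ facet K s, facet_cone s u
  & forall s', facet K s' -> dot u (vert f s') <= dot u (vert f s)].
Proof.
move=> hu; have [s0 fs0] := exists_facet hK hKp.
pose value s := dot u (vert f s).
case: (@Order.TotalTheory.arg_maxP _ _ _ s0 (facet K) value fs0) => s fs smax.
exists s; split=> //; apply: contrapT => /(improve fs hu)[s' fs'].
by apply/negP; rewrite -leNgt; exact: smax.
Qed.

(** For a vertex label [v], an optimal facet in direction [rho R v] has that ray in its cone, hence
    carries the label [v]; the maximum over all facets is therefore [f v]. *)
Lemma vert_in_P_of s : facet K s -> P_of K f (vert f s).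
Proof.
move=> fs; apply/P_ofP; split=> [|i iK|i iK]; first exact: vert_H0.
  have [|s' [fs' cs' /(_ _ fs)]] := exists_max_vert (u := delta R i).
    by rewrite deltaE; exact: center_H0.
  rewrite !dot_delta ?[X in _ <= X](vert_inl _ fs') //; try exact: vert_H0.
  exact: delta_cone_facet cs'.
have [|s' [fs' cs' /(_ _ fs)]] := exists_max_vert (u := - delta R i).
  by rewrite opp_deltaE; exact: center_H0.
have [is' ic'] := opp_delta_cone_facet iK fs' cs'.
by rewrite !dot_opp_delta; try exact: vert_H0; rewrite lerN2 vert_inr.
Qed.

Lemma normal_cone_vert s : facet K s ->
  outer_normal_cone (P_of K f) (vert f s) = facet_cone s.
Proof.
move=> fs; apply/seteqP; split=> u; last first.
  by move=> cu; split=> [|x]; [case: cu|exact: facet_cone_vert_max].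
case=> hu umax; apply: contrapT => /(improve fs hu)[s' fs'].
by rewrite ltNge => /negP; apply; apply: umax; exact: vert_in_P_of.
Qed.

Lemma P_of_verticesE :
  [set v | polytope_vertex (P_of K f) v]%classic =
  [set vert f s | s in [set s | facet K s]]%classic.
Proof.
apply/seteqP; split=> v /=.
  case=> u [c [le eqv]].
  have [vP vc] : P_of K f v /\ dot u v = c.
    by have : [set v]%classic v by []; rewrite -eqv.
  (* The functional exposing [v] need not lie in [H0]; its projection takes the same values
     there. *)
  have uc y : H0 y -> dot (center (u 0)) y = dot u y by move=> hy; rewrite dot_center.
  have [s [fs cs smax]] := exists_max_vert (center_H0 (u 0) n0).
  have sP := vert_in_P_of fs; exists s => //.
  have := facet_cone_vert_max fs cs vP.
  rewrite !uc; [|exact: vert_H0|by case: vP].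
  rewrite vc => ge; suff : ([set v] (vert f s))%classic by exact.
  rewrite -eqv; split=> //; apply/eqP; rewrite eq_le ge andbT; exact: le.
case=> s fs <-; exists (facet_interior R s), (dot (facet_interior R s) (vert f s)).
split=> [x xP|].
  by apply: (facet_cone_vert_max fs) => //; exact: (facet_interior_in _ n0 fs).
apply/seteqP; split=> x /=.
  by case=> xP e; apply: facet_interior_max_uniq => //; rewrite e.
by move=> ->; split=> //; exact: vert_in_P_of.
Qed.

(** Induction on the number of slack coordinates. A general [Q] serves both the hull of the points
    [vert f s] and a given polytope with normal fan F. *)
Lemma P_of_sub_convex (Q : set 'rV[R]_n) : convex_set Q ->
  (forall s, facet K s -> Q (vert f s)) -> (P_of K f `<=` Q)%classic.
Proof.
move=> Qc Qv x; have [N] := ubnP #|[set i | ~~ tight f x i]%SET|.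
elim: N x => // N IH x; rewrite ltnS => xN xP.
have [[a [b [ab ta tb]]]|[c hc]] :
    (exists a b, [/\ a != b, ~~ tight f x a & ~~ tight f x b])
    \/ (exists c, forall i, i != c -> tight f x i).
  have [c tc|none] := pickP (fun i => ~~ tight f x i); last first.
    by right; exists (Ordinal n0) => i _; have /negbFE := none i.
  have [b /andP[bc tb]|none] := pickP (fun i => (i != c) && ~~ tight f x i).
    by left; exists b, c.
  by right; exists c => i ic; have /negbT := none i; rewrite ic negbK.
- have less a' b' t : a' != b' -> ~~ tight f x a' -> ~~ tight f x b' ->
      tight f (x + t *: root_vec R a' b') a' || tight f (x + t *: root_vec R a' b') b' ->
      P_of K f (x + t *: root_vec R a' b') -> Q (x + t *: root_vec R a' b').
    move=> ab' ta' tb' tt; apply: IH; apply: leq_trans xN; apply: proper_card.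
    apply/andP; split.
      apply/fintype.subsetP=> i; rewrite !inE; apply: contra.
      have [->|ia] := eqVneq i a'; first by rewrite (negPf ta').
      have [->|ib] := eqVneq i b'; first by rewrite (negPf tb').
      by rewrite /tight mxE [X in _ + X]mxE root_vecE (negPf ia) (negPf ib) subrr mulr0 addr0.
    apply/negP => /fintype.subsetP sub.
    by case/orP: tt; apply/negP; [have := sub a'|have := sub b']; rewrite !inE; exact.
  have ba : b != a by rewrite eq_sym.
  have [ua la] := ntight_lt xP ta; have [ub lb] := ntight_lt xP tb.
  have [t [t0 tP tt]] := push xP ab ua lb.
  have [r [r0 rP rt]] := push xP ba ub la.
  have Qt := less _ _ _ ab ta tb tt tP; have Qr := less _ _ _ ba tb ta rt rP.
  have tr0 : 0 < t + r by exact: addr_gt0.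
  (* The two pushes go in opposite directions, so weights inversely proportional to their lengths
     cancel them. *)
  have -> : x = (r / (t + r)) *: (x + t *: root_vec R a b)
      + (1 - r / (t + r)) *: (x + r *: root_vec R b a).
    apply/rowP=> i; rewrite !mxE; field; lra.
  apply: Qc => //; first by rewrite divr_ge0 // ltW.
  by rewrite ler_pdivrMr // mul1r lerDr ltW.
(* With at most one slack coordinate, [x] is the unique maximizer of these weights: +1 at a tight
   upper bound, -1 at a tight lower one. An optimal facet gives the same point. *)
- pose w i : R := if i == c then 0 else
    if ([set i]%SET \in K) && (x 0 i == f (inl i)) then 1 else -1.
  have [s [fs cs _]] := exists_max_vert (center_H0 w n0).
  have := facet_cone_vert_max fs cs xP; have := vert_in_P_of fs.
  suff e : dot (center w) x <= dot (center w) (vert f s) -> x = vert f s.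
    by move=> _ /e ->; exact: Qv.
  have /P_ofP[yh y1 y2] := vert_in_P_of fs.
  apply: (H0_eq_weighted (c := c)) => //; first by case: xP.
    by rewrite /w eqxx.
  move=> i ic; rewrite /w (negPf ic); have := hc i ic; rewrite /tight.
  case: ifP => [/andP[iK /eqP ->] _|_ /= /andP[iK /eqP ->]].
    by rewrite oner_eq0 mul1r subr_ge0; split=> //; exact: y1.
  by rewrite oppr_eq0 oner_eq0 mulN1r opprB subr_ge0; split=> //; exact: y2.
Qed.

(** Equality would put a ray belonging to the pivot into the normal cone, which is the facet cone;
    yet the facet carries no label of its pivot. *)
Lemma vert_pivot_strict s : facet K s ->
  ([set s.2]%SET \in K -> vert f s 0 s.2 < f (inl s.2)) /\
  ((~: [set s.2])%SET \notin K -> - f (inr s.2) < vert f s 0 s.2).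
Proof.
move=> fs; have cs := facet_notin fs; have nc := normal_cone_vert fs.
have vP := vert_in_P_of fs; have /P_ofP[hv h1 h2] := vP.
split=> cK; rewrite lt_neqAle ?h1 ?h2 // andbT; apply/eqP => e.
  suff /(delta_cone_facet cK fs) : facet_cone s (delta R s.2) by rewrite (negPf cs).
  rewrite -nc; split=> [|x xP]; first by rewrite deltaE; exact: center_H0.
  by have /P_ofP[hx hx1 _] := xP; rewrite !dot_delta // e hx1.
suff /(opp_delta_cone_facet cK fs)[_] : facet_cone s (- delta R s.2) by rewrite eqxx.
rewrite -nc; split=> [|x xP]; first by rewrite opp_deltaE; exact: center_H0.
by have /P_ofP[hx _ hx2] := xP; rewrite !dot_opp_delta // -e lerN2 hx2.
Qed.

End Fixed.
End SubmodularPolytope.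

(** * Polytopes with normal fan F and their support functions *)

Section NormalFan.
Variables (R : realType) (n : nat) (K : {set {set 'I_n}}).
Hypotheses (hK : simplicial_complex K) (hKp : K \proper [set: {set 'I_n}]%SET).
Hypothesis n0 : (0 < n)%N.
Implicit Types (s : {set 'I_n} * 'I_n) (u x : 'rV[R]_n) (f g : label n -> R).
Implicit Types (P : set 'rV[R]_n).

Lemma convex_polytope_convex P : convex_polytope P -> convex_set P.
Proof.
case=> m [p ->] x y t [a [a0 a1 ->]] [b [b0 b1 ->]] t0 t1.
exists (fun k => t * a k + (1 - t) * b k); split=> [k||].
- by rewrite addr_ge0 // mulr_ge0 // subr_ge0.
- by rewrite big_split /= -!mulr_sumr a1 b1; ring.
- rewrite !scaler_sumr -big_split; apply: eq_bigr => k _.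
  by rewrite /= !scalerA scalerDl.
Qed.

Lemma convex_polytope_max P u x0 : convex_polytope P -> P x0 ->
  exists2 x, P x & forall y, P y -> dot u y <= dot u x.
Proof.
case=> -[|m] [p ->] [a0 [_ a01 _]].
  by move: a01; rewrite big_ord0 => /eqP; rewrite eq_sym oner_eq0.
case: (@Order.TotalTheory.arg_maxP _ _ _ ord0 predT (fun k => dot u (p k)) isT) => k _ kmax.
exists (p k).
  exists (fun i => (i == k)%:R); split=> [i||]; first exact: ler0n.
    by rewrite (bigD1 k)//= eqxx big1 ?addr0 // => j /negPf ->.
  by rewrite (bigD1 k)//= eqxx scale1r big1 ?addr0 // => j /negPf ->; rewrite scale0r.
move=> y [a [a_ge0 a1 ->]]; rewrite dot_sumr -[leRHS]mul1r -a1 mulr_suml.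
by apply: ler_sum => i _; apply: ler_wpM2l => //; exact: kmax.
Qed.

Lemma convex_polytope_P_of f : submodular K f -> convex_polytope (P_of K f).
Proof.
move=> fsub; pose F := [set s | facet K s]%SET.
exists #|F|, (fun k => vert f (enum_val k)).
have FP (k : 'I_#|F|) : facet K (enum_val k) by have := enum_valP k; rewrite /F !inE.
set Q := [set x | _]%classic.
have Qpoly : convex_polytope Q by exists #|F|, (fun k => vert f (enum_val k)).
apply/seteqP; split.
  apply: P_of_sub_convex => // [|s fs]; first exact: convex_polytope_convex.
  have sF : s \in F by rewrite /F inE.
  exists (fun i => (i == enum_rank_in sF s)%:R); split=> [i||]; first exact: ler0n.
    by rewrite (bigD1 (enum_rank_in sF s))//= eqxx big1 ?addr0 // => j /negPf ->.
  rewrite (bigD1 (enum_rank_in sF s))//= eqxx scale1r big1 ?addr0 ?enum_rankK_in //.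
  by move=> j /negPf ->; rewrite scale0r.
move=> x [a [a0 a1 ->]]; split.
  by apply: (big_ind (fun x => H0 x)) => [|y z|k _]; [
    rewrite /H0 /= big1 // => i _; rewrite mxE | exact: H0D
    | apply: H0Z; exact: vert_H0].
move=> v vK; rewrite dot_sumr -[leRHS]mul1r -a1 mulr_suml.
apply: ler_sum => k _; apply: ler_wpM2l => //.
by have [_] := vert_in_P_of hK hKp n0 fsub (FP k); exact.
Qed.

Lemma submodular_normal_fan f : submodular K f ->
  is_normal_fan (bier_fan R K) (P_of K f).
Proof.
move=> fsub; split; [exact: convex_polytope_P_of|by move=> x []|].
rewrite maximal_cones_bier // P_of_verticesE // image_comp.
by apply: eq_imagel => s fs /=; rewrite normal_cone_vert.
Qed.

Lemma delta_in_facet_cone s i : facet K s -> i \in s.1 -> facet_cone s (delta R i).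
Proof.
move=> /facet_notin cs is1; split=> [|k]; rewrite deltaE; first exact: center_H0.
rewrite !center_le; have [e|_] := eqVneq s.2 i; first by rewrite e is1 in cs.
by case: ifPn => ks; rewrite ?ler0n //; case: eqVneq => // e; rewrite e is1 in ks.
Qed.

Lemma opp_delta_in_facet_cone s i : i \notin s.1 -> i != s.2 ->
  facet_cone s (- delta R i).
Proof.
move=> is1 ic; split=> [|k]; rewrite opp_deltaE; first exact: center_H0.
rewrite !center_le [s.2 == i]eq_sym (negPf ic) oppr0 oppr_ge0 oppr_le0 ler0n.
by case: ifPn => // ks; case: eqVneq => // e; rewrite -e ks in is1.
Qed.

Lemma normal_fan_vert P s : is_normal_fan (bier_fan R K) P -> facet K s ->
  exists2 w, P w & outer_normal_cone P w = facet_cone s.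
Proof.
case=> _ _; rewrite maximal_cones_bier // => e fs.
have : [set facet_cone s | s in [set s | facet K s]]%classic
  (facet_cone (R := R) s) by exists s.
rewrite e => -[w [u [c [_ eqw]]] hw]; exists w => //.
by have [] : (P `&` [set x | dot u x = c])%classic w by rewrite eqw.
Qed.

Definition is_support P f := forall v, bier_vertex K v ->
  (forall x, P x -> dot (rho R v) x <= f v) /\
  (exists2 x, P x & dot (rho R v) x = f v).

(** The rays of [s] lie in the normal cone at some point [w] of [P], so [w] attains [f] on each of
    them; these values are all coordinates but the pivot one. *)
Lemma support_vert P f s : is_normal_fan (bier_fan R K) P -> is_support P f ->
  facet K s -> P (vert f s) /\ outer_normal_cone P (vert f s) = facet_cone s.
Proof.
move=> nf fP fs; have [w Pw nw] := normal_fan_vert nf fs.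
have PH0 : (P `<=` H0)%classic by case: nf.
have attained v : bier_vertex K v -> facet_cone s (rho R v) -> dot (rho R v) w = f v.
  move=> vK; rewrite -nw => -[_ wmax]; have [le [x Px xf]] := fP v vK.
  by apply/eqP; rewrite eq_le le // -xf wmax.
suff -> : vert f s = w by [].
apply: (H0_eq_off (c := s.2)); [exact: vert_H0|exact: PH0|] => i ic.
have [is1|is1] := boolP (i \in s.1).
  rewrite (vert_inl _ fs) // -attained ?dot_delta //; first exact: PH0.
    by rewrite bier_vertex_inl //; exact: facet_inl is1.
  exact: delta_in_facet_cone.
rewrite vert_inr // -attained ?dot_opp_delta ?opprK //; first exact: PH0.
  by rewrite bier_vertex_inr //; exact: facet_inr is1 ic.
exact: opp_delta_in_facet_cone.
Qed.

(** A zero jump would give adjacent facets the same normal cone. The jump is not negative, since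
    [vert f s] maximizes an interior functional of its cone that decreases along the edge. *)
Lemma normal_cones_submodular P f :
  (forall s, facet K s -> P (vert f s) /\ outer_normal_cone P (vert f s) = facet_cone s) ->
  submodular K f.
Proof.
move=> h; apply/submodularP => // s a fs ac.
have fns := facet_nbr hK fs ac.
have [Pv nv] := h _ fs; have [Pv' nv'] := h _ fns.
have int_s := facet_interior_in R n0 fs.
rewrite lt_neqAle; apply/andP; split.
  apply/eqP => j0; move/eqP: (nbr_neq fs ac); apply.
  apply: (facet_interior_inj (R := R) hK fs fns).
  by rewrite -nv' vert_nbr // -j0 scale0r addr0 nv.
move: int_s; rewrite -nv => -[_ /(_ _ Pv')].
rewrite vert_nbr // dotDr dotZr gerDl => le.
have : dot (facet_interior R s) (edge R s a) = -1.
  rewrite /edge; case: ifPn => as1; rewrite dot_root_vec centerB eqxx (negPf ac).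
    by rewrite as1 sub0r.
  by rewrite (negPf as1) subr0.
by move=> e; move: le; rewrite e mulrN1 oppr_le0.
Qed.

Lemma exists_support P : is_normal_fan (bier_fan R K) P ->
  exists2 f, is_support P f & forall v, ~~ bier_vertex K v -> f v = 0.
Proof.
move=> nf; have [s fs] := exists_facet hK hKp.
have [x0 Px0 _] := normal_fan_vert nf fs; have [Pp _ _] := nf.
(* The value 0 at labels that are not vertices makes [f] the normalized representative. *)
have /boolp.choice[f hf] : forall v : label n, exists r : R,
    if bier_vertex K v then
      (forall x, P x -> dot (rho R v) x <= r) /\
      (exists2 x, P x & dot (rho R v) x = r)
    else r = 0.
  move=> v.
  case: (bier_vertex K v); last by exists 0.
  have [x Px xmax] := convex_polytope_max (rho R v) Pp Px0.
  by exists (dot (rho R v) x); split=> //; exists x.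
exists f => [v vK|v /negPf vK]; by have := hf v; rewrite vK.
Qed.

Lemma normal_fan_P_of P f : is_normal_fan (bier_fan R K) P -> is_support P f ->
  submodular K f /\ P = P_of K f.
Proof.
move=> nf fP; have hs s := @support_vert P f s nf fP.
have fsub := normal_cones_submodular hs; split=> //.
have [Pp PH0 _] := nf; apply/seteqP; split.
  by move=> x Px; split=> [|v /fP[le _]]; [exact: PH0|exact: le].
apply: P_of_sub_convex => // [|s /hs[]//]; exact: convex_polytope_convex.
Qed.

Lemma exists_facet_inl i : [set i]%SET \in K -> exists2 s, facet K s & i \in s.1.
Proof.
move=> iK; have /properP[_ [B _ BK]] := hKp.
have TK : [set: 'I_n]%SET \notin K.
  by apply: contra BK => h; apply: (complexS hK _ h); exact: finset.subsetT.
have [s [fs is1 _]] := facet_of_chain iK TK (finset.subsetT _).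
by exists s; rewrite // -finset.sub1set.
Qed.

Lemma exists_facet_inr i : (~: [set i])%SET \notin K ->
  exists s, [/\ facet K s, i \notin s.1 & i != s.2].
Proof.
move=> iK; case: (hK) => K0 _.
have [s [fs _ /fintype.subsetP/(_ i)]] := facet_of_chain K0 iK (finset.sub0set _).
rewrite !inE eqxx => h; exists s; split=> //.
  by apply/negP=> is1; have := h; rewrite is1 orbT => /(_ isT).
by apply/eqP=> ic; have := h; rewrite ic eqxx => /(_ isT).
Qed.

(** On a facet carrying [v], the point [vert g s] attains [g v] and obeys the bound [f v]. *)
Lemma P_of_sub_le f g v : submodular K g -> (P_of K g `<=` P_of K f)%classic ->
  bier_vertex K v -> g v <= f v.
Proof.
move=> gsub gf vK; case: v vK => i vK.
  have iK : [set i]%SET \in K by rewrite -bier_vertex_inl.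
  have [s fs is1] := exists_facet_inl iK.
  have /gf[hv /(_ _ vK)] := vert_in_P_of hK hKp n0 gsub fs.
  by rewrite dot_delta // (vert_inl _ fs).
have iK : (~: [set i])%SET \notin K by rewrite -bier_vertex_inr.
have [s [fs is1 ic]] := exists_facet_inr iK.
have /gf[hv /(_ _ vK)] := vert_in_P_of hK hKp n0 gsub fs.
by rewrite dot_opp_delta // vert_inr // opprK.
Qed.

Lemma P_of_eq f g v : submodular K g -> P_of K f = P_of K g ->
  bier_vertex K v -> f v = g v.
Proof.
move=> gsub fg vK; have le w : bier_vertex K w -> g w <= f w.
  by apply: P_of_sub_le => //; rewrite fg.
have le1 i : [set i]%SET \in K -> g (inl i) <= f (inl i).
  by move=> iK; apply: le; rewrite bier_vertex_inl.
have le2 i : (~: [set i])%SET \notin K -> - f (inr i) <= - g (inr i).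
  by move=> iK; rewrite lerN2; apply: le; rewrite bier_vertex_inr.
apply/eqP; rewrite eq_le le // andbT leNgt; apply/negP => gfv.
case: v vK gfv => i vK gfv.
  have iK : [set i]%SET \in K by rewrite -bier_vertex_inl.
  have [s fs is1] := exists_facet_inl iK.
  have vP := vert_in_P_of hK hKp n0 gsub fs.
  have [_ sc] := vert_pivot_strict hK hKp n0 gsub fs.
  have ic : i != s.2 by apply: contraNneq (facet_notin fs) => <-.
  have vPf : P_of K f (vert g s) by rewrite fg.
  (* Raising coordinate [i] at the cost of the pivot: the room below is strict for [g] by
     [vert_pivot_strict], hence for [f] by [le2]. The pushed point violates the bound of [g] at
     [i]. *)
  have [||t [t0]] := push hK hKp vPf ic.
  - by rewrite (vert_inl _ fs).
  - by move=> cK; apply: le_lt_trans (sc cK); exact: le2.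
  rewrite fg => /(P_ofP hK hKp)[_ /(_ i iK) + _] _.
  rewrite mxE [X in _ + X]mxE root_vecE (vert_inl _ fs) //.
  by rewrite eqxx (negPf ic) subr0 mulr1 gerDl leNgt t0.
have iK : (~: [set i])%SET \notin K by rewrite -bier_vertex_inr.
have [s [fs is1 ic]] := exists_facet_inr iK.
have vP := vert_in_P_of hK hKp n0 gsub fs.
have [sc _] := vert_pivot_strict hK hKp n0 gsub fs.
have ci : s.2 != i by rewrite eq_sym.
have vPf : P_of K f (vert g s) by rewrite fg.
have [||t [t0]] := push hK hKp vPf ci.
- by move=> cK; apply: lt_le_trans (sc cK) _; exact: le1.
- by rewrite vert_inr // ltrN2.
rewrite fg => /(P_ofP hK hKp)[_ _ /(_ i iK) +] _.
rewrite mxE [X in _ + X]mxE root_vecE vert_inr //.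
by rewrite eqxx (negPf ic) sub0r mulrN1 lerDl oppr_ge0 leNgt t0.
Qed.

(** A priori [f] could exceed the support function [g] of its polytope at a redundant inequality;
    [P_of_eq] excludes this. *)
Lemma normal_fan_submodular f :
  is_normal_fan (bier_fan R K) (P_of K f) -> submodular K f.
Proof.
move=> nf; have [g gs _] := exists_support nf; have [gsub e] := normal_fan_P_of nf gs.
apply: (normal_cones_submodular (P := P_of K f)) => s; apply: support_vert => //.
by move=> v vK; rewrite (P_of_eq gsub e vK); exact: gs.
Qed.

End NormalFan.

Theorem theorem4 (R : realType) (n : nat) (K : {set {set 'I_n}})
    (hn : (2 <= n)%N) (hK : simplicial_complex K)
    (hKproper : K \proper [set: {set 'I_n}]%SET) :
  [/\ (exists P : set 'rV[R]_n, is_normal_fan (bier_fan R K) P) <->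
        (exists f : label n -> R, submodular K f),
      forall f : label n -> R,
        is_normal_fan (bier_fan R K) (P_of K f) <-> submodular K f
    & set_bij (submodular_functions R K)
        [set P : set 'rV[R]_n | is_normal_fan (bier_fan R K) P]%classic
        (P_of K)].
Proof.
have n0 : (0 < n)%N by exact: ltnW.
(* This serves both the existence equivalence and surjectivity. *)
have ex P : is_normal_fan (bier_fan R K) P ->
    exists f, [/\ submodular K f, forall v, ~~ bier_vertex K v -> f v = 0 & P = P_of K f].
  move=> nf; have [f fP f0] := exists_support hK hKproper n0 nf.
  by have [fsub e] := normal_fan_P_of hK hKproper n0 nf fP; exists f.
split.
- split=> [[P /ex[f [fsub _ _]]]|[f fsub]]; first by exists f.
  by exists (P_of K f); exact: submodular_normal_fan.
- move=> f; split; [exact: normal_fan_submodular|exact: submodular_normal_fan].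
- split=> [f [fsub _]|f g /set_mem[fsub f0] /set_mem[gsub g0] fg|P /ex[f [fsub f0 ->]]].
  + exact: submodular_normal_fan.
  + apply/funext => v; have [vK|vK] := boolP (bier_vertex K v).
      exact: (P_of_eq hK hKproper n0 gsub fg vK).
    by rewrite f0 // g0.
  + by exists f.
Qed.
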